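(* Let $\mathcal{M}$ be a reversible Markov chain on a state space $\Sigma$ with stationary distribution $\pi$ and label function $\omega:\Sigma\to\mathbb{R}$. Let $k\ge 0$ and $m\ge 1$ be integers, let $\varepsilon>0$ and $\alpha>0$ be real numbers, and let $\sigma_0\in\Sigma$ be a fixed state. Consider $m$ independent trajectories $\mathcal{T}^i=(X^i_0,X^i_1,\dots,X^i_{k})$, $i=1,\dots,m$, of length $k$ in $\mathcal{M}$ from the common starting point $X^1_0=\dots=X^m_0=\sigma_0$, and let $\rho$ be the number of trajectories $\mathcal{T}^i$ on which $\sigma_0$ is an $\varepsilon$-outlier, i.e. the number of indices $i$ such that $\omega(\sigma_0)$ is an $\varepsilon$-outlier among $\omega(X^i_0),\dots,\omega(X^i_{k})$. If $\sigma_0$ is not an $(\varepsilon,\alpha)$-outlier in $\mathcal{M}$ with respect to $k$, then for every integer $K\ge 0$, $$\Pr(\rho\ge K)\le\sum_{j=K}^m\binom{m}{j}\left(\frac{2\varepsilon}{\alpha}\right)^{j/2}\left(1-\sqrt{\frac{2\varepsilon}{\alpha}}\right)^{m-j}.$$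
   Context: Markov chains are time-homogeneous, discrete-time, on a discrete state space $\Sigma$, specified by transition probabilities $P(\sigma,\tau)$. A trajectory of $\mathcal{M}$ from $\sigma_0$ is a sequence $X_0=\sigma_0,X_1,X_2,\dots$ of random variables with $\Pr(X_i=\sigma_i\mid X_{i-1}=\sigma_{i-1},\dots,X_0=\sigma_0)=P(\sigma_{i-1},\sigma_i)$. A trajectory is $\pi$-stationary if $X_0\sim\pi$, where $\pi$ is a stationary distribution. $\mathcal{M}$ is reversible if every $\pi$-stationary trajectory $X_0,\dots,X_n$ has the same distribution as its reverse $X_n,\dots,X_0$. A real number $a_0$ is an $\varepsilon$-outlier among $a_0,\dots,a_n$ if $\#\{i\in\{0,\dots,n\}: a_i\le a_0\}\le \varepsilon(n+1)$. For $\sigma\in\Sigma$, let $p^{k}_{0,\varepsilon}(\sigma)$ be the probability that, on a trajectory $\sigma=X_0,X_1,\dots,X_{k}$ of $\mathcal{M}$ started at $\sigma$, $\omega(\sigma)$ is an $\varepsilon$-outlier among $\omega(X_0),\dots,\omega(X_{k})$ (is among the smallest $\varepsilon$ fraction of this list). With respect to $k$, the state $\sigma_0$ is an $(\varepsilon,\alpha)$-outlier in $\mathcal{M}$ if, among all states in $\mathcal{M}$, $p^{k}_{0,\varepsilon}(\sigma_0)$ is in the largest $\alpha$ fraction of the values $p^{k}_{0,\varepsilon}(\sigma)$ over all states $\sigma\in\Sigma$, weighted according to $\pi$; that is, if $\Pr_{\sigma\sim\pi}\big(p^{k}_{0,\varepsilon}(\sigma)\ge p^{k}_{0,\varepsi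lon}(\sigma_0)\big)\le\alpha$.
   Formalization: The formal theorem adds the hypothesis 2ε ≤ α, so that √(2ε/α) is at most 1; without it the stated inequality can fail, e.g. for a one-state chain with k = 0, ε = 1, α = 1/2, m = 2, K = 1, where it would read 1 ≤ 0. *)

(* Defs.v *)
From HB Require Import structures.
From mathcomp Require Import all_boot all_order all_algebra.
From mathcomp Require Import all_classical all_reals all_analysis.
Set Implicit Arguments.
Unset Strict Implicit.
Unset Printing Implicit Defensive.
Import Order.TTheory GRing.Theory Num.Theory.
Local Open Scope classical_set_scope.
Local Open Scope ring_scope.

Definition distribution_on (R : realType) (S : countType) (mu : S -> R) : Prop :=
  (forall s, 0 <= mu s) /\ (\esum_(s in [set: S]) (mu s)%:E = 1)%E.

Definition stochastic (R : realType) (S : countType) (P : S -> S -> R) : Prop :=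
  forall s, distribution_on (P s).

Definition stationary (R : realType) (S : countType) (P : S -> S -> R)
    (pi : S -> R) : Prop :=
  distribution_on pi /\
  forall t, (\esum_(s in [set: S]) (pi s * P s t)%:E = (pi t)%:E)%E.

Definition cond_pr (R : realType) (d : measure_display) (T : measurableType d)
    (Pr : probability T R) (A B : set T) : R :=
  fine (Pr (A `&` B)) / fine (Pr B).

Definition history (T : Type) (S : Type) (X : nat -> T -> S) (s : nat -> S)
    (i : nat) : set T :=
  [set w | forall j, (j <= i)%N -> X j w = s j].

(* Only X 0, ..., X n are constrained: X is a trajectory of length n. The state
   space carries the discrete sigma-algebra, so measurability is tested on
   singletons. *)
Definition trajectory (R : realType) (S : countType) (P : S -> S -> R)
    (d : measure_display) (T : measurableType d) (Pr : probability T R)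
    (n : nat) (X : nat -> T -> S) : Prop :=
  (forall i s, (i <= n)%N -> measurable (X i @^-1` [set s])) /\
  (forall i (s : nat -> S), (i < n)%N -> Pr (history X s i) != 0%E ->
     cond_pr Pr (X i.+1 @^-1` [set s i.+1]) (history X s i) = P (s i) (s i.+1)).

Definition starts_with (R : realType) (S : countType)
    (d : measure_display) (T : measurableType d) (Pr : probability T R)
    (X : nat -> T -> S) (mu : S -> R) : Prop :=
  forall s, Pr (X 0%N @^-1` [set s]) = (mu s)%:E.

Definition point_mass (R : realType) (S : countType) (s0 : S) : S -> R :=
  fun s => (s == s0)%:R.

Definition path_of (T : Type) (S : Type) (n : nat) (X : nat -> T -> S) (w : T) :
    {ffun 'I_n.+1 -> S} :=
  [ffun i : 'I_n.+1 => X i w].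

Definition reversible (R : realType) (S : countType) (P : S -> S -> R)
    (pi : S -> R) : Prop :=
  forall (d : measure_display) (T : measurableType d) (Pr : probability T R)
    (n : nat) (X : nat -> T -> S),
  trajectory P Pr n X -> starts_with Pr X pi ->
  forall A : set {ffun 'I_n.+1 -> S},
    Pr (path_of n X @^-1` A) = Pr (path_of n (fun i => X (n - i)%N) @^-1` A).

(* Elements of V are countably many, so every set of values is an event. *)
Definition independent_family (R : realType) (d : measure_display)
    (T : measurableType d) (Pr : probability T R) (I : finType) (V : countType)
    (Y : I -> T -> V) : Prop :=
  forall (J : {set I}) (A : I -> set V),
    Pr [set w | forall i, i \in J -> A i (Y i w)] =
    (\prod_(i in J) Pr (Y i @^-1` A i))%E.

Definition eps_outlier (R : realType) (eps : R) (n : nat) (a : 'I_n.+1 -> R) :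
    bool :=
  #|[pred i : 'I_n.+1 | a i <= a ord0]|%:R <= eps * n.+1%:R.

(* The law of (X_0, ..., X_n) when X_0 is distributed according to mu; see
   trajectory_law below. *)
Definition path_law (R : realType) (S : countType) (P : S -> S -> R)
    (mu : S -> R) (n : nat) (A : set {ffun 'I_n.+1 -> S}) : \bar R :=
  (\esum_(s in A)
     (mu (s ord0) *
      \prod_(i < n) P (s (widen_ord (leqnSn n) i)) (s (lift ord0 i)))%:E)%E.

Definition outlier_prob (R : realType) (S : countType) (P : S -> S -> R) (omega : S -> R)
    (k : nat) (eps : R) (sigma : S) : \bar R :=
  path_law P (point_mass R sigma)
    [set s : {ffun 'I_k.+1 -> S} | eps_outlier eps (fun i => omega (s i))].

Definition outlier_state (R : realType) (S : countType) (P : S -> S -> R)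
    (pi : S -> R) (omega : S -> R) (k : nat) (eps alpha : R) (sigma0 : S) :
    Prop :=
  (\esum_(s in [set s | outlier_prob P omega k eps sigma0 <=
                   outlier_prob P omega k eps s])
     (pi s)%:E <= alpha%:E)%E.

Lemma measurable_history (S : countType) (d : measure_display)
    (T : measurableType d) (X : nat -> T -> S) (s : nat -> S) (n : nat) :
  (forall i t, (i <= n)%N -> measurable (X i @^-1` [set t])) ->
  measurable (history X s n).
Proof.
move=> mX.
rewrite (_ : history X s n = \bigcap_(i in `I_n.+1) (X i @^-1` [set s i])).
  by apply: fin_bigcap_measurable => // i /= lin; exact: mX.
by apply/seteqP; split=> w /= h i; exact: h.
Qed.

Lemma trajectory_history (R : realType) (S : countType) (P : S -> S -> R)
    (d : measure_display) (T : measurableType d) (Pr : probability T R)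
    (n : nat) (X : nat -> T -> S) (mu : S -> R) (s : nat -> S) :
  trajectory P Pr n X -> starts_with Pr X mu ->
  Pr (history X s n) = (mu (s 0%N) * \prod_(i < n) P (s i) (s i.+1))%:E.
Proof.
move=> [mX tX] X0.
suff H i : (i <= n)%N ->
    Pr (history X s i) = (mu (s 0%N) * \prod_(j < i) P (s j) (s j.+1))%:E.
  exact: H.
elim: i => [_|i IH lin].
  rewrite big_ord0 mulr1 -X0; congr (Pr _); apply/seteqP; split=> w /=.
    by move=> /(_ 0%N); apply.
  by move=> h j; rewrite leqn0 => /eqP ->.
have mh j : (j <= n)%N -> measurable (history X s j).
  by move=> ljn; apply: measurable_history => a t /leq_trans/(_ ljn); exact: mX.
have hE : history X s i.+1 = X i.+1 @^-1` [set s i.+1] `&` history X s i.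
  apply/seteqP; split=> w /=.
    by move=> h; split; [exact: h|move=> j /leqW; exact: h].
  move=> [h1 h2] j; rewrite leq_eqVlt ltnS => /orP[/eqP->//|]; exact: h2.
have := IH (ltnW lin); rewrite big_ord_recr/= mulrA.
have [P0 e|P0 e] := eqVneq (Pr (history X s i)) 0%E.
  have -> : mu (s 0%N) * \prod_(j < i) P (s j) (s j.+1) = 0.
    by move: e; rewrite P0 => -[].
  rewrite mul0r.
  apply/eqP; rewrite eq_le measure_ge0 andbT.
  rewrite -[X in (_ <= X)%E]P0.
  apply: le_measure; rewrite ?inE.
  - exact: mh.
  - by apply: mh; exact: ltnW.
  - by rewrite hE; exact: subIsetr.
have := tX i s lin P0; rewrite /cond_pr -hE e /= => <-.
rewrite mulrC divfK ?fineK ?fin_num_measure//; first exact: mh.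
by move: P0; rewrite e eqe.
Qed.

Lemma trajectory_law (R : realType) (S : countType) (P : S -> S -> R)
    (d : measure_display) (T : measurableType d) (Pr : probability T R)
    (n : nat) (X : nat -> T -> S) (mu : S -> R) (A : set {ffun 'I_n.+1 -> S}) :
  trajectory P Pr n X -> starts_with Pr X mu ->
  Pr (path_of n X @^-1` A) = path_law P mu A.
Proof.
move=> tX X0; pose V : countType := {ffun 'I_n.+1 -> S}.
have pE (s : V) : path_of n X @^-1` [set s] =
    history X (fun j => s (inord j)) n.
  apply/seteqP; split=> w /=.
    by move=> <- j ljn; rewrite ffunE inordK.
  move=> h; apply/ffunP => i; rewrite ffunE h ?inord_val//.
  by rewrite -ltnS.
have mp (s : V) : measurable (path_of n X @^-1` [set s]).
  by rewrite pE; apply: measurable_history; exact: tX.1.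
pose F i := [set s : V | A s /\ pickle s = i].
have FE i : F i = set0 \/ exists2 s : V, A s & F i = [set s] /\ pickle s = i.
  have [->|/set0P[s [As <-]]] := eqVneq (F i) set0; [by left|right].
  exists s => //; split=> //; apply/seteqP; split=> t /=.
    by move=> [_ /(pcan_inj pickleK)].
  by move=> ->.
have mF i : measurable (path_of n X @^-1` F i).
  by have [->|[s _ [-> _]]] := FE i; rewrite ?preimage_set0.
have AF : A = \bigcup_i F i.
  by apply/seteqP; split=> [s As|s [i _ []]//]; exists (pickle s).
have tF : trivIset setT F.
  by move=> i j _ _ [s [[_ <-] [_ <-]]].
have mu0 : forall s : V, (0 <= (mu (s ord0) *
      \prod_(i < n) P (s (widen_ord (leqnSn n) i)) (s (lift ord0 i)))%:E)%E /\
      Pr (path_of n X @^-1` [set s]) = (mu (s ord0) *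
      \prod_(i < n) P (s (widen_ord (leqnSn n) i)) (s (lift ord0 i)))%:E.
  move=> s; suff <- : Pr (path_of n X @^-1` [set s]) = (mu (s ord0) *
      \prod_(i < n) P (s (widen_ord (leqnSn n) i)) (s (lift ord0 i)))%:E.
    by split.
  rewrite pE (trajectory_history _ tX X0); congr (mu (s _) * _)%:E.
    by apply: val_inj; rewrite /= inordK.
  apply: eq_bigr => i _; congr (P (s _) (s _)); apply: val_inj => /=.
    by rewrite inordK// ltnS ltnW.
  by rewrite inordK// ltnS.
rewrite /path_law {2}AF esum_bigcupT//; last first.
- by move=> s; case: (mu0 s).
rewrite {1}AF preimage_bigcup measure_bigcup//; last first.
  by move=> i j _ _ [w [/= [_ <-] [_ <-]]].
rewrite nneseries_esum//; rewrite (_ : [set x | x \in [set: nat]] = setT).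
  apply: eq_esum => i _; have [->|[s _ [-> _]]] := FE i.
    by rewrite preimage_set0 measure0 esum_set0.
  by rewrite esum_set1; case: (mu0 s).
by apply/seteqP; split=> x //= _; rewrite inE.
Qed.

(* Main.v *)
(** Let p(s) be the probability that omega(s) is an eps-outlier on a path of
    length k started at s, and let c be the integer part of eps (k + 1).
    Reversibility makes the two halves of a stationary path X_0, ..., X_k around
    X_j independent paths started at X_j. If X_j is an outlier on both halves,
    then at most 2c of the labels are <= omega(X_j); at most 2c indices j have
    this property, and shorter paths are outliers at least as often as longer
    ones, so (k + 1) E_pi[p^2] <= 2c <= 2 eps (k + 1). If sigma0 is not an
    (eps, alpha)-outlier, then p >= p(sigma0) has pi-mass more than alpha, whence
    alpha p(sigma0)^2 <= 2 eps. By independence rho is binomial with parameters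
    m and p(sigma0), and binomial tails increase with the success probability. *)
Require Import Defs.
From HB Require Import structures.
From mathcomp Require Import all_boot all_order all_algebra.
From mathcomp Require Import all_classical all_reals all_analysis.
From mathcomp Require Import ring.
Set Implicit Arguments.
Unset Strict Implicit.
Unset Printing Implicit Defensive.
Import Order.TTheory GRing.Theory Num.Theory.
Local Open Scope classical_set_scope.
Local Open Scope ring_scope.

(** * Nonnegative sums over arbitrary index sets *)

Lemma esumZl (R : realType) (I : choiceType) (D : set I) (a : I -> \bar R)
    (c : R) : 0 <= c -> (forall i, 0 <= a i)%E ->
  (\esum_(i in D) (c%:E * a i) = c%:E * \esum_(i in D) a i)%E.
Proof.
move=> c0 a0; rewrite /esum -[RHS]ereal_supZl//; last first.
  by apply/set0P; exists 0%E, set0; [exact: fsets_set0|rewrite fsbig_set0].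
congr ereal_sup; apply/seteqP; split=> y /=.
  move=> [X DX <-]; exists (\sum_(i \in X) a i)%E; first by exists X.
  by rewrite ge0_mule_fsumr.
by move=> [_ [X DX <-] <-]; exists X => //; rewrite ge0_mule_fsumr.
Qed.

Lemma exchange_esum (R : realType) (I J : choiceType) (a : I -> J -> \bar R) :
  (forall i j, 0 <= a i j)%E ->
  (\esum_(i in [set: I]) \esum_(j in [set: J]) a i j =
   \esum_(j in [set: J]) \esum_(i in [set: I]) a i j)%E.
Proof.
move=> a0; rewrite !esum_esum//.
apply: (reindex_esum _ _ (fun x : J * I => (x.2, x.1))); split=> //=.
  by move=> [i j] [i' j'] _ _ [-> ->].
by move=> [i j] _; exists (j, i).
Qed.

(** * Expectations along a path, one step at a time *)

(** This is the expectation of [f [:: X_1; ...; X_n]] for the chain with [X_0 = s]. The start is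
    kept out of the list, so that the first step can be split off by passing to
    [fun l => f (t :: l)]. *)
Fixpoint path_expect (R : realType) (S : countType) (P : S -> S -> R) (n : nat)
    (f : seq S -> \bar R) (s : S) : \bar R :=
  if n is n'.+1 then
    (\esum_(t in [set: S])
       ((P s t)%:E * path_expect P n' (fun l => f (t :: l)) t))%E
  else f [::].

Lemma stochastic_ge0 (R : realType) (S : countType) (P : S -> S -> R) :
  stochastic P -> forall s t, 0 <= P s t.
Proof. by move=> + s => /(_ s)[]. Qed.

Lemma path_expect_ge0 (R : realType) (S : countType) (P : S -> S -> R)
    (stochP : stochastic P) (n : nat) (f : seq S -> \bar R) (s : S) :
  (forall l, 0 <= f l)%E -> (0 <= path_expect P n f s)%E.
Proof.
elim: n f s => [|n IH] f s f0 //=; apply: esum_ge0 => t _.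
by rewrite mule_ge0 ?lee_fin ?(stochastic_ge0 stochP)//; exact: IH.
Qed.

Lemma le_path_expect (R : realType) (S : countType) (P : S -> S -> R)
    (stochP : stochastic P) (n : nat) (f g : seq S -> \bar R) (s : S) :
  (forall l, 0 <= f l)%E -> (forall l, size l = n -> f l <= g l)%E ->
  (path_expect P n f s <= path_expect P n g s)%E.
Proof.
elim: n f g s => [|n IH] f g s f0 fg /=; first exact: fg.
apply: le_esum => t _; apply: lee_wpmul2l.
  by rewrite lee_fin (stochastic_ge0 stochP).
by apply: IH => // l sl; apply: fg; rewrite /= sl.
Qed.

Lemma eq_path_expect (R : realType) (S : countType) (P : S -> S -> R)
    (n : nat) (f g : seq S -> \bar R) (s : S) :
  f =1 g -> path_expect P n f s = path_expect P n g s.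
Proof. by move=> /funext ->. Qed.

Lemma path_expect_cst (R : realType) (S : countType) (P : S -> S -> R)
    (stochP : stochastic P) (n : nat) (c : R) (s : S) : 0 <= c ->
  path_expect P n (fun=> c%:E) s = c%:E.
Proof.
move=> c0; elim: n s => [//|n IH] s /=.
under eq_esum do rewrite IH muleC.
rewrite esumZl//; last by move=> t; rewrite lee_fin (stochastic_ge0 stochP).
by rewrite (stochP s).2 mule1.
Qed.

Lemma path_expectZl (R : realType) (S : countType) (P : S -> S -> R)
    (stochP : stochastic P) (n : nat) (c : R) (f : seq S -> \bar R) (s : S) :
  0 <= c -> (forall l, 0 <= f l)%E ->
  (path_expect P n (fun l => c%:E * f l) s = c%:E * path_expect P n f s)%E.
Proof.
move=> c0; elim: n f s => [//|n IH] f s f0 /=.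
rewrite -esumZl//.
  by apply: eq_esum => t _; rewrite IH// muleCA.
move=> t; rewrite mule_ge0 ?lee_fin ?(stochastic_ge0 stochP)//.
exact: path_expect_ge0.
Qed.

Lemma path_expect_esum (R : realType) (S : countType) (P : S -> S -> R)
    (stochP : stochastic P) (I : choiceType) (n : nat)
    (f : I -> seq S -> \bar R) (s : S) :
  (forall i l, 0 <= f i l)%E ->
  (path_expect P n (fun l => \esum_(i in [set: I]) f i l) s =
   \esum_(i in [set: I]) path_expect P n (f i) s)%E.
Proof.
elim: n f s => [//|n IH] f s f0 /=.
transitivity (\esum_(t in [set: S]) \esum_(i in [set: I])
    ((P s t)%:E * path_expect P n (fun l => f i (t :: l)) t))%E.
  apply: eq_esum => t _; rewrite (IH (fun i l => f i (t :: l)))// esumZl//.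
    exact: (stochastic_ge0 stochP).
  by move=> i; exact: path_expect_ge0.
rewrite exchange_esum// => t i.
by rewrite mule_ge0 ?lee_fin ?(stochastic_ge0 stochP)//; exact: path_expect_ge0.
Qed.

Lemma path_expect_sum (R : realType) (S : countType) (P : S -> S -> R)
    (stochP : stochastic P) (m n : nat)
    (f : 'I_m -> seq S -> \bar R) (s : S) :
  (forall i l, 0 <= f i l)%E ->
  (path_expect P n (fun l => \sum_(i < m) f i l) s =
   \sum_(i < m) path_expect P n (f i) s)%E.
Proof.
elim: n f s => [//|n IH] f s f0 /=; rewrite -esum_sum.
  apply: eq_esum => t _; rewrite (IH (fun i l => f i (t :: l)))//.
  rewrite ge0_sume_distrr// => i _.
  exact: path_expect_ge0.
move=> t i _ _.
by rewrite mule_ge0 ?lee_fin ?(stochastic_ge0 stochP)//; exact: path_expect_ge0.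
Qed.

(** The steps beyond the first [a] only append states at the end of the list, which lowers [f]. Once
    [a] steps are used up, the rest is an average of values below [f [::]] with total weight 1. *)
Lemma path_expect_nincr (R : realType) (S : countType) (P : S -> S -> R)
    (stochP : stochastic P) (a b : nat) (f : seq S -> R) (s : S) :
  (forall l, 0 <= f l) -> (forall l t, f (rcons l t) <= f l) -> (a <= b)%N ->
  (path_expect P b (EFin \o f) s <= path_expect P a (EFin \o f) s)%E.
Proof.
elim: a b f s => [|a IH] b f s f0 fr ab.
  have fn l : f l <= f [::].
    by elim/last_ind: l => // l t; apply: le_trans; exact: fr.
  rewrite /= -(path_expect_cst stochP b s (f0 [::])).
  by apply: le_path_expect => // l _ /=; rewrite lee_fin.
case: b ab => // b ab /=; apply: le_esum => t _; apply: lee_wpmul2l.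
  by rewrite lee_fin (stochastic_ge0 stochP).
by apply: (IH b (fun l => f (t :: l))) => // l u; rewrite -rcons_cons.
Qed.

(** * Stationary paths seen from an inner position *)

(** A base point [s] drawn from [pi] sits at position [a]. The list [l] runs away from it into the
    past and [r] into the future, so [catrev l (s :: r)] is the whole path in order of time. *)
Definition two_sided_expect (R : realType) (S : countType) (P : S -> S -> R)
    (pi : S -> R) (a b : nat) (f : seq S -> \bar R) : \bar R :=
  (\esum_(s in [set: S]) ((pi s)%:E *
     path_expect P a (fun l => path_expect P b (fun r => f (catrev l (s :: r))) s)
       s))%E.

(** Detailed balance reads the first step into the past, from [s] to [t], as a first step into the
    future, from [t] to [s]. The base point moves to [t] and the path in order of time stays the
    same. *)
Lemma two_sided_expect_shift (R : realType) (S : countType) (P : S -> S -> R)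
    (stochP : stochastic P) (pi : S -> R) (pi_ge0 : forall s, 0 <= pi s)
    (balance : forall s t, pi s * P s t = pi t * P t s)
    (a b : nat) (f : seq S -> \bar R) : (forall l, 0 <= f l)%E ->
  two_sided_expect P pi a.+1 b f = two_sided_expect P pi a b.+1 f.
Proof.
move=> f0; rewrite /two_sided_expect /=.
pose G s t := path_expect P a
  (fun l => path_expect P b (fun r => f (catrev l (t :: s :: r))) s) t.
have G0 s t : (0 <= G s t)%E.
  by apply: path_expect_ge0 => // l; exact: path_expect_ge0.
have PG0 s t u v : (0 <= (P s t)%:E * G u v)%E.
  by rewrite mule_ge0 ?lee_fin ?(stochastic_ge0 stochP).
transitivity (\esum_(s in [set: S]) \esum_(t in [set: S])
    ((pi s)%:E * ((P s t)%:E * G s t)))%E.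
  by apply: eq_esum => s _; rewrite esumZl.
rewrite exchange_esum; last by move=> s t; rewrite mule_ge0// lee_fin.
apply: eq_esum => t _.
rewrite path_expect_esum//; last first.
  move=> s l; rewrite mule_ge0 ?lee_fin ?(stochastic_ge0 stochP)//.
  exact: path_expect_ge0.
transitivity (\esum_(s in [set: S]) ((pi t)%:E * ((P t s)%:E * G s t)))%E.
  by apply: eq_esum => s _; rewrite !muleA -!EFinM balance.
rewrite esumZl//; congr (_ * _)%E; apply: eq_esum => s _.
rewrite path_expectZl//; first exact: (stochastic_ge0 stochP).
by move=> l; exact: path_expect_ge0.
Qed.

Lemma two_sided_expectE (R : realType) (S : countType) (P : S -> S -> R)
    (stochP : stochastic P) (pi : S -> R) (pi_ge0 : forall s, 0 <= pi s)
    (balance : forall s t, pi s * P s t = pi t * P t s)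
    (a b : nat) (f : seq S -> \bar R) : (forall l, 0 <= f l)%E ->
  two_sided_expect P pi a b f = two_sided_expect P pi 0 (a + b) f.
Proof.
move=> f0; elim: a b => [//|a IH] b.
by rewrite two_sided_expect_shift// IH addnS.
Qed.

(** * How many entries of a list can have small rank *)

Lemma exists_max_seq (R : realType) (p : pred R) (x : seq R) : has p x ->
  exists2 a, p a & forall b, b \in x -> p b -> b <= a.
Proof.
elim: x => // a x IH /=; have [px _|npx] := boolP (has p x).
  have [c pc cmax] := IH px; case: (boolP (p a)) => pa.
    exists (Num.max a c); first by rewrite /Num.max; case: ifP.
    by move=> b; rewrite inE le_max => /orP[/eqP->|/cmax/[apply]->];
      rewrite ?lexx ?orbT.
  exists c => // b; rewrite inE => /orP[/eqP->|/cmax//].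
  by rewrite (negbTE pa).
rewrite orbF => pa; exists a => // b; rewrite inE => /orP[/eqP->//|bx pb].
by case/hasP: npx; exists b.
Qed.

(* The largest of the counted terms dominates all of them. *)
Lemma count_count_le (R : realType) (c : nat) (x : seq R) :
  (count (fun a => count (<= a)%R x <= c)%N x <= c)%N.
Proof.
case: (boolP (has (fun a => count (<= a)%R x <= c)%N x)); last first.
  by rewrite has_count -leqNgt leqn0 => /eqP ->.
move=> /exists_max_seq[a ac amax]; apply: leq_trans ac.
rewrite -(@eq_in_count _ (predI (mem x) (fun a => count (<= a)%R x <= c)%N)).
  by apply: sub_count => b /andP[]; exact: amax.
by move=> b /= ->.
Qed.

Lemma sum_count_nth_le (R : realType) (c n : nat) (x : seq R) : size x = n ->
  (\sum_(j < n) (count (<= x`_j)%R x <= c) <= c)%N.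
Proof.
move=> <-; apply: leq_trans (count_count_le c x).
by rewrite -sum1_count (big_nth 0) big_mkord [leqRHS]big_mkcond.
Qed.

(** * The second moment of the outlier probability *)

Lemma path_expectM (R : realType) (S : countType) (P : S -> S -> R)
    (stochP : stochastic P) (a b : nat) (f g : seq S -> R) (s : S) :
  (forall l, 0 <= f l) -> (forall l, 0 <= g l <= 1) ->
  (path_expect P a (fun l => path_expect P b (fun r => (f l * g r)%:E) s) s =
   path_expect P a (EFin \o f) s * path_expect P b (EFin \o g) s)%E.
Proof.
move=> f0 g01.
have g0 l : (0 <= (EFin \o g) l)%E by rewrite lee_fin; case/andP: (g01 l).
(* Finiteness makes the expectation of [g] a real scalar, which [path_expectZl] can pull out of the
   expectation of [f]. *)
have gfin : path_expect P b (EFin \o g) s \is a fin_num.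
  rewrite ge0_fin_numE; last exact: path_expect_ge0.
  apply: le_lt_trans (ltry 1).
  rewrite -(path_expect_cst stochP b s ler01).
  by apply: le_path_expect => // l _; rewrite lee_fin; case/andP: (g01 l).
rewrite -(fineK gfin) muleC -path_expectZl//; last first.
  exact/fine_ge0/path_expect_ge0.
apply: eq_path_expect => l; rewrite fineK// muleC -path_expectZl//.
Qed.

Lemma sume_cst_ord (R : realType) (n : nat) (x : \bar R) :
  (\sum_(j < n) x = n%:R%:E * x)%E.
Proof.
rewrite mule_natl; elim: n => [|n IH]; first by rewrite big_ord0.
by rewrite big_ord_recl IH muleS.
Qed.

(* [X_0] itself is not counted, hence the strict inequality. *)
Definition smallest_prob (R : realType) (S : countType) (P : S -> S -> R)
    (omega : S -> R) (k c : nat) (s : S) : \bar R :=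
  path_expect P k
    (fun l => (count (fun t => omega t <= omega s)%R l < c)%N%:R%:E) s.

(** The factor [k.+1] counts the possible positions of the base point. Summed over them, the second
    moment is at most the expected number of positions of rank at most [2 * c] on one stationary
    path. *)
Lemma esum_smallest_prob_square_le (R : realType) (S : countType) (P : S -> S -> R)
    (stochP : stochastic P) (pi : S -> R) (pi_distr : distribution_on pi)
    (balance : forall s t, pi s * P s t = pi t * P t s)
    (omega : S -> R) (k c : nat) :
  (k.+1%:R%:E * (\esum_(s in [set: S])
     ((pi s)%:E * (smallest_prob P omega k c s * smallest_prob P omega k c s)))
   <=
   (2 * c)%:R%:E)%E.
Proof.
have [pi_ge0 pi1] := pi_distr.
pose h s l : R := (count (fun t => omega t <= omega s)%R l < c)%N%:R.
have h0 s l : 0 <= h s l by [].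
have h1 s l : 0 <= h s l <= 1 by rewrite h0/= lern1; case: (_ < _)%N.
set p := smallest_prob P omega k c.
(* Indicator that the label at position [j] has rank at most [2 * c] on the whole path. *)
pose F j (l : seq S) : \bar R :=
  (count (<= (map omega l)`_j)%R (map omega l) <= 2 * c)%N%:R%:E.
have F0 j l : (0 <= F j l)%E by rewrite lee_fin.
have step j : (j <= k)%N ->
    ((\esum_(s in [set: S]) ((pi s)%:E * (p s * p s))) <=
     two_sided_expect P pi j (k - j) (F j))%E.
  move=> jk; apply: le_esum => s _; apply: lee_wpmul2l; first by rewrite lee_fin.
  (* Appending a state can only raise the count, so the indicator [h s] satisfies the hypothesis of
     [path_expect_nincr]. *)
  have ple i : (i <= k)%N -> (p s <= path_expect P i (EFin \o h s) s)%E.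
    apply: path_expect_nincr => // l t; rewrite /h ler_nat -cats1 count_cat.
    by case: (leqP c (count _ l)) => cl; rewrite ?leq_b1// ltnNge
      (leq_trans cl (leq_addr _ _)).
  have p0 : (0 <= p s)%E by apply: path_expect_ge0 => // l; rewrite lee_fin.
  apply: (le_trans (lee_pmul p0 p0 (ple _ jk) (ple _ (leq_subr j k)))).
  rewrite -path_expectM//; apply: le_path_expect => // [l|l sl].
    by apply: path_expect_ge0 => // r; rewrite lee_fin mulr_ge0.
  apply: le_path_expect => // r; first by rewrite lee_fin mulr_ge0.
  move=> _; rewrite lee_fin /h -natrM mulnb ler_nat.
  case: andP => [[lc rc]|_]; last by [].
  (* Entry [j] is the base point, because the past has length [j]. It counts itself once, and the
     strict inequality [lc] leaves room for this. *)
  rewrite catrevE map_cat nth_cat size_map size_rev sl ltnn subnn /=.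
  rewrite count_cat /= lexx map_rev count_rev !count_map addnCA.
  rewrite mul2n -addnn.
  by have := leq_add lc (ltnW rc); rewrite addSn add1n lt0b.
set Q := (\esum_(s in _) _)%E.
have -> : (k.+1%:R%:E * Q = \sum_(j < k.+1) Q)%E.
  by rewrite sume_cst_ord.
apply: (@le_trans _ _ (\sum_(j < k.+1) two_sided_expect P pi 0 k (F j))%E).
  apply: lee_sum => j _.
  have jk : (j <= k)%N by rewrite -ltnS.
  (* Moving the base point to time 0 makes every term an expectation over the same path, so the sum
     over [j] can go inside. *)
  by have := step j jk; rewrite two_sided_expectE// subnKC.
rewrite /two_sided_expect /= -esum_sum; last first.
  move=> s j _ _; rewrite mule_ge0 ?lee_fin//; exact: path_expect_ge0.
rewrite -[leRHS]mule1 -pi1 -esumZl//.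
apply: le_esum => s _; rewrite -ge0_sume_distrr; last first.
  by move=> j _; exact: path_expect_ge0.
rewrite [leRHS]muleC; apply: lee_wpmul2l; first by rewrite lee_fin.
rewrite -(path_expect_sum stochP k (f := fun (j : 'I_k.+1) l => F j (s :: l)))//.
rewrite -(path_expect_cst stochP k s (ler0n R (2 * c))).
apply: le_path_expect => // [l|l sl]; first by rewrite sume_ge0.
rewrite sumEFin lee_fin -natr_sum ler_nat.
by apply: (sum_count_nth_le (2 * c) (x := map omega (s :: l))); rewrite size_map/= sl.
Qed.

(** * Binomial tails and their monotonicity *)

Definition binomial_tail (R : realType) (m K : nat) (p : R) : R :=
  \sum_(K <= j < m.+1) 'C(m, j)%:R * p ^+ j * (1 - p) ^+ (m - j).

Lemma binomial_tail_mkcond (R : realType) (m K : nat) (p : R) :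
  binomial_tail m K p =
  \sum_(j < m.+1 | (K <= j)%N) 'C(m, j)%:R * p ^+ j * (1 - p) ^+ (m - j).
Proof. by rewrite /binomial_tail (big_nat_widenl K 0)// big_mkord. Qed.

Lemma binomial_tail0 (R : realType) (m : nat) (p : R) : binomial_tail m 0 p = 1.
Proof.
have := exprDn (1 - p) p m; rewrite subrK expr1n => ->.
rewrite /binomial_tail big_mkord; apply: eq_bigr => j _.
by rewrite -mulrA mulr_natl mulrC.
Qed.

Lemma binomial_tail_nincr (R : realType) (m K : nat) (p : R) :
  0 <= p <= 1 -> binomial_tail m K.+1 p <= binomial_tail m K p.
Proof.
move=> /andP[p0 p1]; rewrite !binomial_tail_mkcond.
rewrite [leLHS]big_mkcond [leRHS]big_mkcond/=; apply: ler_sum => j _.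
have : 0 <= 'C(m, j)%:R * p ^+ j * (1 - p) ^+ (m - j).
  by rewrite !mulr_ge0// exprn_ge0// subr_ge0.
by case: ltngtP => // _ ->.
Qed.

(** Condition on one of the trials: its success leaves [K] to reach, its failure [K.+1].
    Algebraically this is Pascal's rule. *)
Lemma binomial_tailS (R : realType) (m K : nat) (p : R) :
  binomial_tail m.+1 K.+1 p =
  p * binomial_tail m K p + (1 - p) * binomial_tail m K.+1 p.
Proof.
have [mK|Km] := ltnP m K.
  by rewrite /binomial_tail !big_geq ?mulr0 ?addr0// ltnS ltnW.
rewrite /binomial_tail big_add1 /=.
under eq_bigr do rewrite binS natrD !mulrDl.
rewrite big_split [LHS]addrC /=; congr (_ + _).
  rewrite mulr_sumr; apply: eq_bigr => j _; rewrite subSS exprS; ring.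
rewrite big_nat_recr//= bin_small// !mul0r addr0.
rewrite [in RHS]big_add1 mulr_sumr; apply: eq_big_nat => j /andP[_ jm].
by rewrite subSS -(subnSK jm) !exprS; ring.
Qed.

(** By induction on [m] the tails inside [binomial_tailS] grow when [p] becomes [q]. Then the weight
    moves from the tail at [K.+1] to the larger tail at [K]. *)
Lemma le_binomial_tail (R : realType) (m K : nat) (p q : R) :
  0 <= p -> p <= q -> q <= 1 -> binomial_tail m K p <= binomial_tail m K q.
Proof.
move=> p0 pq q1; elim: m K => [|m IH] [|K]; rewrite ?binomial_tail0//.
  by rewrite /binomial_tail !big_geq.
rewrite !binomial_tailS.
apply: (@le_trans _ _
    (p * binomial_tail m K q + (1 - p) * binomial_tail m K.+1 q)).
  by apply: lerD; apply: ler_wpM2l; rewrite ?IH// subr_ge0 (le_trans pq).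
have : binomial_tail m K.+1 q <= binomial_tail m K q.
  by apply: binomial_tail_nincr; rewrite q1 (le_trans p0).
move=> t; rewrite -subr_ge0.
(* This product is exactly the gain from replacing the weight [p] by [q]. *)
have : 0 <= (binomial_tail m K q - binomial_tail m K.+1 q) * (q - p).
  by rewrite mulr_ge0// subr_ge0.
by congr (0 <= _); ring.
Qed.

(** * The number of successes among independent trials *)

Lemma independent_count_ge (R : realType) (d : measure_display)
    (T : measurableType d) (Pr : probability T R) (m : nat) (V : countType)
    (Y : 'I_m -> T -> V) (o : pred V) (p : R) (K : nat) :
  independent_family Pr Y ->
  (forall i (A : set V), measurable (Y i @^-1` A)) ->
  (forall i, Pr (Y i @^-1` [set v | o v]) = p%:E) ->
  Pr [set w | (K <= #|[pred i | o (Y i w)]|)%N] = (binomial_tail m K p)%:E.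
Proof.
move=> indepY mY Yp.
(* The event that [B] is exactly the set of successes. These events are disjoint, and those with
   [K <= #|B|] make up the event in question. *)
pose F (B : {set 'I_m}) := [set w | forall i, o (Y i w) = (i \in B)].
pose D := [set B : {set 'I_m} | (K <= #|B|)%N]%SET.
have FE B : F B =
    \bigcap_(i in [set: 'I_m]) (Y i @^-1` [set v | o v = (i \in B)]).
  by apply/seteqP; split=> w h i; [move=> _; exact: h|exact: h].
have mF B : measurable (F B).
  by rewrite FE; apply: fin_bigcap_measurable => // i _; exact: mY.
have PF B : Pr (F B) = (p ^+ #|B| * (1 - p) ^+ (m - #|B|))%:E.
  transitivity (\prod_(i < m) (if i \in B then p else 1 - p)%:E)%E.
    have := indepY [set: 'I_m]%SET (fun i => [set v | o v = (i \in B)]).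
    rewrite (_ : [set w | _] = F B); last first.
      by apply/seteqP; split=> w h i; [apply: h; rewrite inE|move=> _; exact: h].
    move=> ->; rewrite (eq_bigl predT); last by move=> i; rewrite inE.
    apply: eq_bigr => i _; case: ifPn => iB; first exact: Yp.
    rewrite (_ : _ @^-1` _ = ~` (Y i @^-1` [set v | o v])).
      by rewrite probability_setC// Yp.
    by apply/seteqP; split=> w /=; [move=> ->|move/negP/negbTE].
  rewrite prodEFin; congr (_%:E).
  rewrite (bigID (mem B))/= [X in X * _](eq_bigr (fun=> p)); last first.
    by move=> i ->.
  rewrite [X in _ * X](eq_bigr (fun=> 1 - p)); last by move=> i /negbTE ->.
  rewrite !prodr_const; congr (_ * _ ^+ _).
  by rewrite -(addKn #|B| #|_|) cardC card_ord.
have -> : [set w | (K <= #|[pred i | o (Y i w)]|)%N] =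
    \big[setU/set0]_(i < #|D|) F (enum_val i).
  apply/seteqP; split=> w.
    move=> Kw; have wD : [set i | o (Y i w)]%SET \in D.
      rewrite inE; move: Kw => /=; congr (_ <= _)%N.
      by apply: eq_card => i; rewrite !inE.
    rewrite -bigcup_seq; exists (enum_rank_in wD [set i | o (Y i w)]%SET).
      exact: mem_index_enum.
    by rewrite enum_rankK_in// => i; rewrite inE.
  rewrite -bigcup_seq => -[i _ /= Fw].
  have := enum_valP i; rewrite inE; congr (_ <= _)%N; apply: eq_card => j.
  by rewrite inE Fw.
rewrite measure_bigsetU_ord//; last first.
  move=> i j _ _ [w [Fi Fj]]; apply: enum_val_inj; apply/setP => l.
  by rewrite -Fi -Fj.
rewrite -(big_enum_val (fun B => Pr (F B))) /=.
under eq_bigr do rewrite PF.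
rewrite sumEFin binomial_tail_mkcond; congr (_%:E).
have DE B : (B \in D) = (K <= #|B|)%N by rewrite inE.
rewrite (eq_bigl _ _ DE).
have cardm (B : {set 'I_m}) : (#|B| < m.+1)%N.
  by rewrite ltnS -[leqRHS]card_ord max_card.
(* Group the sets by cardinality: the class of [j] has ['C(m, j)] members of equal probability. *)
rewrite (partition_big (fun B : {set 'I_m} => inord #|B| : 'I_m.+1)
  (fun j : 'I_m.+1 => (K <= j)%N)) /=; last first.
  by move=> B; rewrite inordK.
apply: eq_bigr => j Kj.
rewrite (eq_bigr (fun=> p ^+ j * (1 - p) ^+ (m - j))); last first.
  by move=> B /andP[_ /eqP <-]; rewrite inordK.
rewrite sumr_const -mulrA mulr_natl; congr (_ *+ _).
rewrite -[X in 'C(X, _)](card_ord m) -card_draws; apply: eq_card => B.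
rewrite !inE unfold_in -val_eqE/= inordK//.
by case: eqP => [->|]; rewrite ?andbT ?andbF.
Qed.

(** * From reversibility to detailed balance *)

(** Reversibility speaks about given trajectories, so a stationary trajectory of length 1 must be
    built. Reversing it on the event that it goes from [s0] to [t0] yields the equation. *)
Lemma reversible_detailed_balance (R : realType) (S : countType)
    (P : S -> S -> R) (pi : S -> R) :
  stochastic P -> distribution_on pi -> reversible P pi ->
  forall s t, pi s * P s t = pi t * P t s.
Proof.
move=> stochP [pi0 pi1] revP s0 t0.
pose w (v : S * S) := (pi v.1 * P v.1 v.2)%:E.
have w0 v : (0 <= w v)%E.
  by rewrite lee_fin mulr_ge0// (stochastic_ge0 stochP).
(* The sample space is [nat]: a pair [(X_0, X_1)] is represented by its code and carries the mass
   [w]. *)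
pose mu (A : set nat) := (\esum_(v in [set v : S * S | A (pickle v)]) w v)%E.
have mu0 : mu set0 = 0%E by exact: esum_set0.
have mu_ge0 A : (0 <= mu A)%E by exact: esum_ge0.
have mu_sigma : semi_sigma_additive mu.
  move=> F mF tF mUF; rewrite (_ : mu _ = \sum_(0 <= i <oo) mu (F i))%E.
    by apply: is_cvg_ereal_nneg_natsum => i _; exact: mu_ge0.
  rewrite -nneseries_sum_bigcup//.
  by move=> i j _ _ [v [Fi Fj]]; apply: tF => //; exists (pickle v).
have muX (C : set (S * S)) (A : set nat) :
    (forall v, A (pickle v) <-> C v) -> mu A = (\esum_(v in C) w v)%E.
  by move=> AC; congr esum; apply/seteqP; split=> v /AC.
have mu_fst s : (\esum_(v in [set v : S * S | v.1 = s]) w v = (pi s)%:E)%E.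
  have -> : [set v : S * S | v.1 = s] = [set s] `*`` (fun=> [set: S]).
    by apply/seteqP; split=> v /= => [->|[]].
  rewrite -(esum_esum (a := fun s t => w (s, t)))// esum_set1; last exact: esum_ge0.
  rewrite /w/=; under eq_esum do rewrite EFinM.
  rewrite esumZl ?(stochP s).2 ?mule1// => t.
  by rewrite lee_fin (stochastic_ge0 stochP).
have muT : mu [set: nat] = 1%E.
  rewrite (muX ([set: S] `*`` (fun=> [set: S]))); last by move=> v; split.
  rewrite -(esum_esum (a := fun s t => w (s, t)))// -pi1; apply: eq_esum => s _.
  rewrite -mu_fst.
  have -> : [set v : S * S | v.1 = s] = [set s] `*`` (fun=> [set: S]).
    by apply/seteqP; split=> v /= => [->|[]].
  by rewrite -(esum_esum (a := fun s t => w (s, t)))// esum_set1//; exact: esum_ge0.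
pose muM := isMeasure.Build _ nat R mu mu0 mu_ge0 mu_sigma.
pose muMeas : {measure set nat -> \bar R} := HB.pack mu muM.
pose muP := Measure_isProbability.Build _ _ _ muMeas muT.
pose Q : probability nat R := HB.pack mu muM muP.
(* The default [(s0, t0)] is taken only at numbers that code no pair, and these have mass 0 under
   [mu]. *)
pose X (i n : nat) : S := let v := odflt (s0, t0) (unpickle n) in
  if i is 0%N then v.1 else v.2.
have QE A : Q A = mu A by [].
have muX0 s : mu (X 0%N @^-1` [set s]) = (pi s)%:E.
  rewrite -mu_fst; apply: muX => v; by rewrite /X /= pickleK.
have muX01 s t : mu (X 1%N @^-1` [set t] `&` X 0%N @^-1` [set s]) =
    (pi s * P s t)%:E.
  rewrite (muX [set (s, t)]) ?esum_set1//.
  move=> [a b]; rewrite /X /= pickleK /=; split; first by move=> [-> ->].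
  by move=> [-> ->].
have trajX : trajectory P Q 1 X.
  split=> // i s; rewrite ltnS leqn0 => /eqP ->.
  have -> : history X s 0 = X 0%N @^-1` [set s 0%N].
    apply/seteqP; split=> n /=; first by move=> /(_ 0%N); exact.
    by move=> h j; rewrite leqn0 => /eqP ->.
  rewrite /cond_pr !QE muX0 muX01 /= eqe => pis.
  by rewrite mulrC mulKf.
have startX : starts_with Q X pi by move=> s; rewrite QE muX0.
have := revP _ _ Q 1%N X trajX startX
  [set p | p ord0 = s0 /\ p (lift ord0 ord0) = t0].
rewrite !QE.
have -> : path_of 1 X @^-1` [set p | p ord0 = s0 /\ p (lift ord0 ord0) = t0] =
    X 1%N @^-1` [set t0] `&` X 0%N @^-1` [set s0].
  by apply/seteqP; split=> n /=; rewrite !ffunE => -[].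
have -> : path_of 1 (fun i => X (1 - i)%N) @^-1`
      [set p | p ord0 = s0 /\ p (lift ord0 ord0) = t0] =
    X 1%N @^-1` [set s0] `&` X 0%N @^-1` [set t0].
  by apply/seteqP; split=> n /=; rewrite !ffunE => -[].
by rewrite !muX01 => -[].
Qed.

(** * Path laws as iterated expectations *)

Lemma path_law_expect (R : realType) (S : countType) (P : S -> S -> R)
    (stochP : stochastic P) (mu : S -> R) (mu_ge0 : forall s, 0 <= mu s)
    (n : nat) (f : seq S -> \bar R) (f_ge0 : forall l, (0 <= f l)%E) :
  (\esum_(s in [set: {ffun 'I_n.+1 -> S}])
     ((mu (s ord0) *
       \prod_(i < n) P (s (widen_ord (leqnSn n) i)) (s (lift ord0 i)))%:E *
      f (map s (enum 'I_n.+1))) =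
   \esum_(s in [set: S]) ((mu s)%:E * path_expect P n (fun l => f (s :: l)) s))%E.
Proof.
elim: n mu mu_ge0 f f_ge0 => [|n IH] mu mu_ge0 f f_ge0.
  pose e t : {ffun 'I_1 -> S} := [ffun=> t].
  rewrite (reindex_esum [set: S] _ e); last first.
    split=> // [s t _ _ /ffunP/(_ ord0)|s _]; first by rewrite !ffunE.
    by exists (s ord0) => //; apply/ffunP => i; rewrite ffunE (ord1 i).
  apply: eq_esum => s _; rewrite big_ord0 mulr1 ffunE enum_ordSl /= ffunE.
  by rewrite (_ : enum 'I_0 = [::])//; apply: size0nil; rewrite size_enum_ord.
(* A path is its first state glued to the remaining path, which is again a path, with initial law
   [P s] in place of [mu]. *)
pose e (x : S * {ffun 'I_n.+1 -> S}) : {ffun 'I_n.+2 -> S} :=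
  [ffun i => if unlift ord0 i is Some j then x.2 j else x.1].
have e0 x : e x ord0 = x.1 by rewrite ffunE unlift_none.
have eS x i : e x (lift ord0 i) = x.2 i by rewrite ffunE liftK.
rewrite (reindex_esum ([set: S] `*`` (fun=> [set: {ffun 'I_n.+1 -> S}])) _ e);
    last first.
  split=> // [[s g] [t h] _ _ /ffunP eq|g _].
    congr (_, _); first by have := eq ord0; rewrite !e0.
    by apply/ffunP => i; have := eq (lift ord0 i); rewrite !eS.
  exists (g ord0, [ffun i => g (lift ord0 i)]) => //.
  apply/ffunP => i; rewrite ffunE.
  by case: unliftP => [j ->|->]//=; rewrite ffunE.
pose a s (g : {ffun 'I_n.+1 -> S}) := ((mu s)%:E * ((P s (g ord0) *
       \prod_(i < n) P (g (widen_ord (leqnSn n) i)) (g (lift ord0 i)))%:E *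
      f (s :: map g (enum 'I_n.+1))))%E.
have a0 s g : (0 <= a s g)%E.
  rewrite !mule_ge0 ?lee_fin// mulr_ge0 ?(stochastic_ge0 stochP)//.
  by apply: prodr_ge0 => i _; exact: stochastic_ge0.
transitivity (\esum_(s in [set: S]) \esum_(g in [set: {ffun 'I_n.+1 -> S}]) a s g)%E.
  rewrite esum_esum//; apply: eq_esum => -[s g] _ /=.
  rewrite /a muleA -EFinM big_ord_recl e0 eS /=; congr (_%:E * f _)%E.
    rewrite -(eS (s, g)) (_ : widen_ord _ _ = ord0); last exact: val_inj.
    rewrite e0 eS; congr (_ * (_ * _)); apply: eq_bigr => i _.
    rewrite eS (_ : widen_ord _ _ = lift ord0 (widen_ord (leqnSn n) i)) ?eS//.
    exact: val_inj.
  rewrite enum_ordSl /= e0 -map_comp; congr cons.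
  by apply: eq_map => i /=; rewrite eS.
apply: eq_esum => s _; rewrite esumZl//; last first.
  move=> g; rewrite mule_ge0 ?lee_fin// mulr_ge0 ?(stochastic_ge0 stochP)//.
  by apply: prodr_ge0 => i _; exact: stochastic_ge0.
by rewrite (IH (P s) _ (fun l => f (s :: l)))//; exact: stochastic_ge0.
Qed.

Lemma outlier_probE (R : realType) (S : countType) (P : S -> S -> R)
    (stochP : stochastic P) (omega : S -> R) (k : nat) (eps : R) (s : S) :
  0 <= eps ->
  outlier_prob P omega k eps s =
  smallest_prob P omega k (Num.truncn (eps * k.+1%:R)) s.
Proof.
move=> eps0; set c := Num.truncn _.
pose f (l : seq S) : \bar R :=
  (* Only nonempty lists occur here, so [head s l] is the first state and the default is never
     taken. *)
  (count (fun t => omega t <= omega (head s l))%R l <= c)%N%:R%:E.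
rewrite /outlier_prob /path_law esum_mkcond.
transitivity (\esum_(g in [set: {ffun 'I_k.+1 -> S}])
   ((point_mass R s (g ord0) *
     \prod_(i < k) P (g (widen_ord (leqnSn k) i)) (g (lift ord0 i)))%:E *
    f (map g (enum 'I_k.+1))))%E.
  apply: eq_esum => g _.
  suff -> : (g \in [set s0 : {ffun 'I_k.+1 -> S} |
        eps_outlier eps (fun i => omega (s0 i))]) =
      (count (fun t => omega t <= omega (head s (map g (enum 'I_k.+1))))%R
        (map g (enum 'I_k.+1)) <= c)%N.
    by rewrite /f; case: (_ <= _)%N; rewrite ?mule1 ?mule0.
  have -> : count (fun t => omega t <= omega (head s (map g (enum 'I_k.+1))))%R
      (map g (enum 'I_k.+1)) = #|[pred i | omega (g i) <= omega (g ord0)]|.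
    rewrite -sum1_card -sum1_count big_map big_enum_cond enum_ordSl /=.
    by apply: eq_bigl => i; rewrite inE.
  rewrite /c truncn_ge_nat ?mulr_ge0//.
  by apply/idP/idP => [/set_mem//|h]; exact: mem_set.
have pm0 t : 0 <= point_mass R s t by exact: ler0n.
have f0 l : (0 <= f l)%E by rewrite lee_fin.
rewrite path_law_expect// (esumID [set s]) ?setTI; last first.
  by move=> t _; rewrite mule_ge0 ?lee_fin//; exact: path_expect_ge0.
rewrite esum_set1; last first.
  by rewrite mule_ge0 ?lee_fin//; exact: path_expect_ge0.
rewrite esum1 ?adde0; last first.
  by move=> t /= /eqP/negbTE ts; rewrite /point_mass ts mul0e.
rewrite /point_mass eqxx mul1e /smallest_prob; apply: eq_path_expect => l.
(* The start counts itself, so at most [c] on the whole path means fewer than [c] among the later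
   states. *)
by rewrite /f /= lexx.
Qed.

Lemma measurable_path_of (R : realType) (S : countType) (P : S -> S -> R)
    (d : measure_display) (T : measurableType d) (Pr : probability T R)
    (n : nat) (X : nat -> T -> S) (A : set {ffun 'I_n.+1 -> S}) :
  trajectory P Pr n X -> measurable (path_of n X @^-1` A).
Proof.
move=> [mX _].
have -> : path_of n X @^-1` A =
    \bigcup_s [set w | path_of n X w = s /\ A s].
  apply/seteqP; split=> w /=; first by exists (path_of n X w).
  by move=> [s _ [<-]].
apply: countable_bigcupT_measurable; first exact: countableP.
move=> s; have [As|nAs] := pselect (A s); last first.
  by rewrite (_ : [set _ | _] = set0)//; apply/seteqP; split=> w // [].
rewrite (_ : [set _ | _] = \bigcap_(i in [set: 'I_n.+1]) (X i @^-1` [set s i])).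
  by apply: fin_bigcap_measurable => // i _; apply: mX; rewrite -ltnS.
apply/seteqP; split=> w /= => [[<- _] i _|h]; first by rewrite ffunE.
by split=> //; apply/ffunP => i; rewrite ffunE; exact: h.
Qed.

(** * The bound for a state that is not an outlier, and the conclusion *)

Lemma not_outlier_state_le (R : realType) (S : countType) (P : S -> S -> R)
    (pi : S -> R) (omega : S -> R) (stochP : stochastic P)
    (pi_distr : distribution_on pi) (revP : reversible P pi)
    (k : nat) (eps alpha : R) (eps_gt0 : 0 < eps) (alpha_gt0 : 0 < alpha)
    (sigma0 : S) :
  ~ outlier_state P pi omega k eps alpha sigma0 ->
  exists2 p : R, outlier_prob P omega k eps sigma0 = p%:E &
    0 <= p <= Num.sqrt (2 * eps / alpha).
Proof.
move=> nout; set c := Num.truncn (eps * k.+1%:R).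
have pE s : outlier_prob P omega k eps s = smallest_prob P omega k c s.
  by rewrite outlier_probE// ltW.
have p_ge0 s : (0 <= smallest_prob P omega k c s)%E.
  by apply: path_expect_ge0 => // l; rewrite lee_fin.
have p_fin : smallest_prob P omega k c sigma0 \is a fin_num.
  rewrite ge0_fin_numE//; apply: le_lt_trans (ltry 1).
  rewrite -(path_expect_cst stochP k sigma0 ler01).
  by apply: le_path_expect => // l; rewrite ?lee_fin// lern1 leq_b1.
exists (fine (smallest_prob P omega k c sigma0)); first by rewrite fineK.
rewrite fine_ge0//=; set p := fine _.
have pp : smallest_prob P omega k c sigma0 = p%:E by rewrite fineK.
have p0 : 0 <= p by exact: fine_ge0.
have [pi0 _] := pi_distr.
(* Markov's inequality for the squared probability: keep only the states at least as likely as
   [sigma0] to be outliers, whose mass exceeds [alpha]. *)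
have H : ((alpha * (p * p))%:E <= \esum_(s in [set: S])
    ((pi s)%:E * (smallest_prob P omega k c s * smallest_prob P omega k c s)))%E.
  apply: (@le_trans _ _ (\esum_(s in [set s | outlier_prob P omega k eps sigma0 <=
                   outlier_prob P omega k eps s]) ((p * p)%:E * (pi s)%:E))%E).
    rewrite esumZl ?mulr_ge0// EFinM muleC.
    by apply: lee_wpmul2l; rewrite ?lee_fin ?mulr_ge0// ltW// ltNge; apply/negP.
  rewrite [leLHS]esum_mkcond; apply: le_esum => s _.
  case: ifPn => [/set_mem/=|_]; last by rewrite !mule_ge0 ?lee_fin.
  rewrite !pE pp => ps; rewrite muleC; apply: lee_wpmul2l; first by rewrite lee_fin.
  by rewrite EFinM; apply: lee_pmul; rewrite ?lee_fin.
have := esum_smallest_prob_square_le stochP pi_distr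
  (reversible_detailed_balance stochP pi_distr revP) omega k c.
have k0 : (0 <= k.+1%:R%:E :> \bar R)%E by rewrite lee_fin.
move=> /(le_trans (lee_wpmul2l k0 H)); rewrite -EFinM lee_fin natrM => Hc.
have ck : c%:R <= eps * k.+1%:R by rewrite truncn_le mulr_ge0// ltW.
have : alpha * (p * p) <= 2 * eps.
  rewrite -(@ler_pM2l _ k.+1%:R)//; apply: le_trans Hc _.
  by rewrite mulrCA ler_pM2l// mulrC.
rewrite mulrC -ler_pdivlMr// => pr.
by rewrite -(ger0_norm p0) -sqrtr_sqr ler_wsqrtr// expr2.
Qed.

Theorem theorem5p1 (R : realType) (S : countType) (P : S -> S -> R)
    (pi : S -> R) (omega : S -> R)
    (stochP : stochastic P) (statpi : stationary P pi)
    (revP : reversible P pi)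
    (k m : nat) (m_ge1 : (1 <= m)%N)
    (eps alpha : R) (eps_gt0 : 0 < eps) (alpha_gt0 : 0 < alpha)
    (eps_le : 2 * eps <= alpha)
    (sigma0 : S)
    (d : measure_display) (T : measurableType d) (Pr : probability T R)
    (X : 'I_m -> nat -> T -> S)
    (trajX : forall i, trajectory P Pr k (X i))
    (startX : forall i, starts_with Pr (X i) (point_mass R sigma0))
    (indepX : independent_family Pr (fun i => path_of k (X i)))
    (not_outlier : ~ outlier_state P pi omega k eps alpha sigma0)
    (K : nat) :
  let rho (w : T) : nat :=
    #|[pred i : 'I_m |
        eps_outlier eps (fun j : 'I_k.+1 => omega (X i j w))]| in
  (Pr [set w | (K <= rho w)%N] <=
   (\sum_(K <= j < m.+1)
      'C(m, j)%:R * (2 * eps / alpha) `^ (j%:R / 2) *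
      (1 - Num.sqrt (2 * eps / alpha)) ^+ (m - j))%:E)%E.
Proof.
cbv zeta beta; set r := 2 * eps / alpha.
have r0 : 0 <= r by rewrite divr_ge0 ?mulr_ge0 ?ltW.
have [p pE /andP[p0 pr]] :=
  not_outlier_state_le stochP statpi.1 revP eps_gt0 alpha_gt0 not_outlier.
pose o (v : {ffun 'I_k.+1 -> S}) := eps_outlier eps (fun j => omega (v j)).
(* Being an outlier depends on the path alone, so [indepX] applies to these events. *)
have oE w :
    #|[pred i | eps_outlier eps (fun j : 'I_k.+1 => omega (X i j w))]| =
    #|[pred i | o (path_of k (X i) w)]|.
  apply: eq_card => i; rewrite !inE /o; congr eps_outlier.
  by apply/funext => j; rewrite ffunE.
under eq_set do rewrite oE.
rewrite (independent_count_ge (o := o) (p := p) K indepX); first last.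
- by move=> i; rewrite (trajectory_law _ (trajX i) (startX i)) -pE.
- by move=> i A; exact: measurable_path_of (trajX i).
(* The success probability [Num.sqrt r] has to be at most 1, which is where [eps_le] enters. *)
rewrite lee_fin; apply: le_trans (le_binomial_tail m K p0 pr _) _.
  by rewrite -[leRHS]sqrtr1 ler_wsqrtr// ler_pdivrMr// mul1r.
rewrite /binomial_tail le_eqVlt; apply/orP; left; apply/eqP.
apply: eq_bigr => j _; congr (_ * _ * _).
by rewrite [_ / 2]mulrC powRrM powR12_sqrt// powR_mulrn// sqrtr_ge0.
Qed.
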